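(* Let $B$ be a standard one-dimensional Brownian motion with $B_0=0$. Then for all $R,T>0$, $$\mathbb P\left(\left|\frac1{T^2}\int_0^TB_t^2\,dt-\frac12\right|\ge R\right)\le2^{1/3}\left(1\wedge\frac{4R+3/4}{3R^2}\right)\exp\left(-\frac{R^2}{3(4R+3/4)}\right).$$
   Context: $a\wedge b=\min(a,b)$. *)

(* Defs.v *)
From HB Require Import structures.
From mathcomp Require Import all_boot all_order all_algebra.
From mathcomp Require Import all_classical all_reals all_analysis.
From mathcomp Require Import measurable_realfun.

Set Implicit Arguments.
Unset Strict Implicit.
Unset Printing Implicit Defensive.

Import Order.TTheory GRing.Theory Num.Theory.
Import numFieldNormedType.Exports.

Local Open Scope classical_set_scope.
Local Open Scope ring_scope.

Definition mutually_independent (R : realType) (d : measure_display)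
    (Omega : measurableType d) (P : probability Omega R) (I : finType)
    (X : I -> {RV P >-> R}) : Prop :=
  forall (J : {set I}) (A : I -> set R),
    (forall i, i \in J -> measurable (A i)) ->
    (P (\bigcap_(i in [set i | i \in J]) (X i @^-1` A i)) =
     \prod_(i in J) P (X i @^-1` A i))%E.

(* The two measures are compared on Borel sets only: their values on other
   sets carry no information. *)
Definition normally_distributed (R : realType) (d : measure_display)
    (Omega : measurableType d) (P : probability Omega R) (m sigma : R)
    (X : {RV P >-> R}) : Prop :=
  forall A : set R, measurable A ->
    distribution P X A = normal_prob m sigma A.

(* Time is [0, +oo[: the values of B at negative times are unconstrained.
   Every path is continuous, so that path functionals are random variables
   without any completeness assumption on P.  In [bm_gaussian] the parameter of
   the normal law is the standard deviation, and s < t is strict because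
   [normal_prob m 0] is not the Dirac mass at m. *)
Record standard_brownian_motion (R : realType) (d : measure_display)
    (Omega : measurableType d) (P : probability Omega R)
    (B : R -> {RV P >-> R}) : Prop := StandardBrownianMotion {
  bm_start : {ae P, forall w, B 0 w = 0} ;
  bm_indep : forall (n : nat) (t : nat -> R),
    0 <= t 0%N -> (forall i, (i < n)%N -> t i <= t i.+1) ->
    mutually_independent
      (fun i : 'I_n => (B (t i.+1) - B (t i) : {RV P >-> R})) ;
  bm_gaussian : forall s t : R, 0 <= s -> s < t ->
    normally_distributed 0 (Num.sqrt (t - s))
      (B t - B s : {RV P >-> R}) ;
  bm_continuous : forall w : Omega,
    {within `[0, +oo[, continuous (fun t : R => B t w)} }.

(* Main.v *)
Require Import Defs.
From HB Require Import structures.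
From mathcomp Require Import all_boot all_order all_algebra.
From mathcomp Require Import all_classical all_reals all_analysis.
From mathcomp Require Import measurable_realfun.
From mathcomp Require Import ring lra.

(** For R <= 3/2 the claimed bound is at least 1.  For R > 3/2 the energy
    E = T^-2 * int_0^T B_t^2 dt, being nonnegative, can deviate from 1/2 by R
    only upwards.  So the upper tail E >= R + 1/2 is what has to be estimated,
    and a crude exponential moment suffices because the claimed bound decays
    no faster than exp (- R / 12) / R.

    Write E / 2 as the average of B_t^2 / (4 t) against the probability density
    2 t / T^2 on ]0, T].  Jensen's inequality gives
    exp (E / 2) <= int_0^T (2 t / T^2) exp (B_t^2 / (4 t)) dt
    ([expR_energy_le]).  The weight is chosen so that the law of B_t^2 / t does
    not depend on t: as B_t is centred Gaussian with variance t,
    exp (B_t^2 / (4 t)) has expectation sqrt 2 ([brownian_motion_exp_sqr]), and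
    Tonelli's theorem makes the expectation of the right-hand side equal to
    sqrt 2 ([integral_jensen_integrand_bm]).  Markov's inequality then yields
    P (E >= a) <= sqrt 2 * exp (- a / 2) ([energy_tail]), which at a = R + 1/2
    is below the claimed bound ([tail_le_bound]).

    Tonelli's theorem needs (t, w) |-> B t w to be jointly measurable; this
    follows from the continuity of the paths, by approximating the process with
    step processes on the grids of mesh 1 / n
    ([measurable_fun_continuous_paths]). *)

Set Implicit Arguments.
Unset Strict Implicit.
Unset Printing Implicit Defensive.

Import Order.TTheory GRing.Theory Num.Theory.
Import numFieldNormedType.Exports.

Local Open Scope classical_set_scope.
Local Open Scope ring_scope.

(** * The Gaussian exponential moment *)

(** The density [normal_pdf] agrees almost everywhere with the Radon-Nikodym
    derivative, which turns the change of variables for the latter into this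
    formula. *)
Lemma ge0_integral_normal_prob (K : realType) (m s : K) (f : K -> \bar K) :
  measurable_fun [set: K] f -> (forall x, 0 <= f x)%E ->
  (\int[normal_prob m s]_x f x
   = \int[lebesgue_measure]_x (f x * (normal_pdf m s x)%:E))%E.
Proof.
move=> mf f0.
have dom := @normal_prob_dominates K m s.
rewrite -(Radon_Nikodym_SigmaFinite.change_of_variables dom)//.
have ig := Radon_Nikodym_SigmaFinite.f_integrable dom.
have mpdf : measurable_fun [set: K] (fun x => (normal_pdf m s x)%:E).
  by apply/measurable_EFinP; exact: measurable_normal_pdf.
apply: ae_eq_integral => //.
- by apply: emeasurable_funM => //; exact: measurable_int ig.
- exact: emeasurable_funM.
- apply: ae_eqe_mul2l; apply: integral_ae_eq => // A _ mA.
  by rewrite -Radon_Nikodym_SigmaFinite.f_integral.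
Qed.

(** Multiplying a centred Gaussian density by exp (x^2 / (4 s^2)) halves the
    exponent, so it produces the density of twice the variance up to the factor
    sqrt 2 between the two normalisations; the moment below is this factor. *)
Lemma expR_sqr_normal_pdf (K : realType) (s x : K) : 0 < s ->
  expR (x ^+ 2 / (4 * s ^+ 2)) * normal_pdf 0 s x
  = Num.sqrt 2 * normal_pdf 0 (Num.sqrt 2 * s) x.
Proof.
move=> s0; have r0 : 0 < Num.sqrt 2 :> K by rewrite sqrtr_gt0.
have sN0 : s != 0 by rewrite gt_eqF.
have rsN0 : Num.sqrt 2 * s != 0 by rewrite gt_eqF ?mulr_gt0.
rewrite !normal_pdfE//= /normal_peak /normal_fun !subr0.
rewrite mulrCA -expRD exprMn sqr_sqrtr//.
have -> : 2 * s ^+ 2 * pi *+ 2 = 2 * (s ^+ 2 * pi *+ 2) :> K by ring.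
rewrite sqrtrM// !mulrA; congr (_ * expR _); last by field.
by rewrite invfM mulVKf ?gt_eqF.
Qed.

Lemma integral_expR_sqr_normal (K : realType) (s : K) : 0 < s ->
  (\int[normal_prob 0 s]_x (expR (x ^+ 2 / (4 * s ^+ 2)))%:E
   = (Num.sqrt 2)%:E)%E.
Proof.
move=> s0; rewrite ge0_integral_normal_prob; first last.
- by move=> x; rewrite lee_fin expR_ge0.
- apply/measurable_EFinP/measurableT_comp => //.
  by apply: measurable_funM => //; exact: exprn_measurable.
under eq_integral do rewrite -EFinM expR_sqr_normal_pdf// EFinM.
rewrite integralZl ?integral_normal_pdf ?mule1//.
exact: integrable_normal_pdf.
Qed.

Lemma ge0_integral_normally_distributed (K : realType) (d : measure_display)
    (Omega : measurableType d) (P : probability Omega K) (m s : K)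
    (X : {RV P >-> K}) (f : K -> \bar K) :
  normally_distributed m s X ->
  measurable_fun [set: K] f -> (forall x, 0 <= f x)%E ->
  (\int[P]_w f (X w) = \int[normal_prob m s]_x f x)%E.
Proof.
move=> nX mf f0.
have hX : measurable_fun [set: Omega] X by [].
(* The normal law is a measure on [measurableTypeR K], which has the same
   measurable sets as K but is another structure. *)
have mX : measurable_fun [set: Omega] (X : Omega -> measurableTypeR K).
  exact: hX.
have := @ge0_integral_pushforward _ _ _ (measurableTypeR K) _ _ mX P setT f
  measurableT mf.
rewrite preimage_setT => <- //.
apply: eq_measure_integral => A mA _.
exact: nX.
Qed.

Lemma brownian_motion_exp_sqr (K : realType) (d : measure_display)
    (Omega : measurableType d) (P : probability Omega K)
    (B : K -> {RV P >-> K}) (t : K) :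
  standard_brownian_motion B -> 0 < t ->
  (\int[P]_w (expR (B t w ^+ 2 / (4 * t)))%:E = (Num.sqrt 2)%:E)%E.
Proof.
move=> hB t0.
have m4 : measurable_fun [set: K] (fun x => (expR (x ^+ 2 / (4 * t)))%:E).
  apply/measurable_EFinP/measurableT_comp => //.
  by apply: measurable_funM => //; exact: exprn_measurable.
have s0 : 0 < Num.sqrt t by rewrite sqrtr_gt0.
rewrite -(@integral_expR_sqr_normal K (Num.sqrt t))// sqr_sqrtr ?ltW//.
have := bm_gaussian hB (lexx 0) t0; rewrite subr0 => nB.
rewrite -(ge0_integral_normally_distributed nB m4) => [|x]; last first.
  by rewrite lee_fin expR_ge0.
apply: ge0_ae_eq_integral => //.
- exact: measurableT_comp m4 _.
- exact: measurableT_comp m4 _.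
- move: (bm_start hB); apply: filterS => w B0 _ /=.
  by rewrite [(_ - _) w](_ : _ = B t w - B 0 w)// B0 subr0.
Qed.

(** * Joint measurability and Tonelli's theorem *)

Lemma cvg_truncn_grid (K : realType) (t : K) : 0 <= t ->
  (Num.truncn (t * n.+1%:R))%:R / n.+1%:R @[n --> \oo] --> t.
Proof.
move=> t0; apply: (@squeeze_cvgr _ _ _ _ (fun n => t - n.+1%:R^-1) (cst t)).
- near=> n; have n0 : (0 : K) < n.+1%:R by [].
  have tn0 : 0 <= t * n.+1%:R by rewrite mulr_ge0.
  have /andP[le_tn lt_tn] := truncn_itv tn0.
  rewrite ler_pdivrMr// le_tn andbT ler_pdivlMr// mulrBl mulVf ?gt_eqF//.
  by rewrite lerBlDr natr1 ltW.
- rewrite -[X in _ --> X]subr0; apply: cvgB; first exact: cvg_cst.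
  exact: cvg_harmonic.
- exact: cvg_cst.
Unshelve. all: by end_near. Qed.

(** The step process that follows X on the grid of mesh 1 / (n + 1) is constant
    in time on each cell, so a preimage is a countable union of rectangles. *)
Lemma measurable_fun_grid (K : realType) (d : measure_display)
    (Omega : measurableType d) (X : K -> Omega -> K) (n : nat) :
  (forall t, 0 <= t -> measurable_fun [set: Omega] (X t)) ->
  measurable_fun
    (`[0, +oo[%classic `*` setT : set (measurableTypeR K * Omega))
    (fun z => X ((Num.truncn (z.1 * n.+1%:R))%:R / n.+1%:R) z.2).
Proof.
move=> mX _ A mA; have n0 : (0 : K) < n.+1%:R by [].
rewrite [X in measurable X](_ : _ = \bigcup_(k : nat)
  (`[k%:R / n.+1%:R, k.+1%:R / n.+1%:R[%classic
   `*` (X (k%:R / n.+1%:R) @^-1` A))).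
  apply: bigcup_measurable => k _; apply: measurableX.
    exact: measurable_itv.
  by rewrite -[_ @^-1` _]setTI; apply: mX => //; rewrite divr_ge0.
apply/seteqP; split => [[t w] /= [[]]|[t w] [k _] /= []].
- rewrite in_itv/= andbT => t0 _ XA.
  exists (Num.truncn (t * n.+1%:R)) => //=; split => //.
  by rewrite in_itv/= ler_pdivrMr// ltr_pdivlMr// truncn_itv// mulr_ge0.
- rewrite !in_itv/= andbT ler_pdivrMr// ltr_pdivlMr// => tk XA.
  rewrite (truncn_def tk); split => //; split => //.
  have /andP[kt _] := tk.
  by rewrite -(pmulr_lge0 _ n0); apply: le_trans kt.
Qed.

(** The grid times converge to t within [0, +oo[, hence by continuity of the
    paths the process is the pointwise limit of its step approximations. *)
Lemma measurable_fun_continuous_paths (K : realType) (d : measure_display)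
    (Omega : measurableType d) (X : K -> Omega -> K) :
  (forall t, 0 <= t -> measurable_fun [set: Omega] (X t)) ->
  (forall w, {within `[0, +oo[, continuous (fun t => X t w)}) ->
  measurable_fun
    (`[0, +oo[%classic `*` setT : set (measurableTypeR K * Omega))
    (fun z => X z.1 z.2).
Proof.
move=> mX cX.
apply: (measurable_fun_cvg (fun n => @measurable_fun_grid _ _ _ X n mX)).
move=> [t w] [/= t0 _]; have {}t0 : 0 <= t by move: t0; rewrite in_itv/= andbT.
have /subspace_continuousP/(_ t) := cX w; rewrite /= in_itv/= t0 => /(_ isT).
pose grid n : K := (Num.truncn (t * n.+1%:R))%:R / n.+1%:R.
apply: (@cvg_comp _ _ _ grid (fun s => X s w)) => U DU.
have : \forall n \near \oo, `[0, +oo[%classic (grid n) -> U (grid n).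
  by have /(_ _ DU) := cvg_truncn_grid t0.
suff : \forall n \near \oo, `[0, +oo[%classic (grid n).
  by apply: filterS2 => n /= Dn; apply.
by apply: nearW => n; rewrite /= in_itv/= andbT divr_ge0.
Qed.

Lemma measurable_patch_setX (K : realType) (d1 d2 : measure_display)
    (T1 : measurableType d1) (T2 : measurableType d2) (D : set T1)
    (f : T1 * T2 -> \bar K) :
  measurable D -> measurable_fun (D `*` setT) f ->
  measurable_fun setT (f \_ (D `*` setT)).
Proof.
by move=> mD mf; apply/(measurable_restrictT _ _).1 => //; exact: measurableX.
Qed.

Lemma patch_setX (K : realType) (T1 T2 : Type) (D : set T1)
    (f : T1 * T2 -> \bar K) x y :
  (f \_ (D `*` setT)) (x, y) = ((fun x => f (x, y)) \_ D) x.
Proof. by rewrite !patchE in_setX in_setT andbT. Qed.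

Lemma patch_setX_ge0 (K : realType) (T1 T2 : Type) (D : set T1)
    (f : T1 * T2 -> \bar K) :
  (forall z, D z.1 -> 0 <= f z)%E ->
  forall z, (0 <= (f \_ (D `*` setT)) z)%E.
Proof.
move=> f0 [x y]; rewrite patch_setX patchE.
by case: ifPn => // /set_mem Dx; apply: f0.
Qed.

Lemma measurable_fun_integral_setX (K : realType) (d1 d2 : measure_display)
    (T1 : measurableType d1) (T2 : measurableType d2)
    (m1 : {sigma_finite_measure set T1 -> \bar K}) (D : set T1)
    (f : T1 * T2 -> \bar K) :
  measurable D -> measurable_fun (D `*` setT) f ->
  (forall z, D z.1 -> 0 <= f z)%E ->
  measurable_fun setT (fun y => \int[m1]_(x in D) f (x, y))%E.
Proof.
move=> mD mf f0.
have := @measurable_fun_fubini_tonelli_G _ _ _ _ _ m1 _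
  (measurable_patch_setX mD mf) (patch_setX_ge0 f0).
congr measurable_fun.
apply/funext => y; rewrite /fubini_G [RHS]integral_mkcond.
by apply: eq_integral => x _; rewrite patch_setX.
Qed.

Lemma fubini_tonelli_setX (K : realType) (d1 d2 : measure_display)
    (T1 : measurableType d1) (T2 : measurableType d2)
    (m1 : {sigma_finite_measure set T1 -> \bar K})
    (m2 : {sigma_finite_measure set T2 -> \bar K}) (D : set T1)
    (f : T1 * T2 -> \bar K) :
  measurable D -> measurable_fun (D `*` setT) f ->
  (forall z, D z.1 -> 0 <= f z)%E ->
  (\int[m2]_y \int[m1]_(x in D) f (x, y)
   = \int[m1]_(x in D) \int[m2]_y f (x, y))%E.
Proof.
move=> mD mf f0.
have := @fubini_tonelli _ _ _ _ _ m1 m2 _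
  (measurable_patch_setX mD mf) (patch_setX_ge0 f0).
under [X in _ = X -> _]eq_integral do under eq_integral do rewrite patch_setX.
under [X in _ = X -> _]eq_integral do rewrite -integral_mkcond.
move=> <-; rewrite [RHS]integral_mkcond; apply: eq_integral => x _.
rewrite patchE; case: ifPn => xD.
  by apply: eq_integral => y _; rewrite patch_setX patchE xD.
by apply: integral0_eq => y _; rewrite patch_setX patchE (negbTE xD).
Qed.

(** * Jensen's inequality along a path *)

Lemma measurable_invr (K : realType) : measurable_fun [set: K] (@GRing.inv K).
Proof.
(* The square makes the base nonnegative, and both sides are 0 at x = 0. *)
rewrite (_ : GRing.inv = fun x : K => x * (x ^+ 2) `^ (-1)).
  apply: measurable_funM => //; apply: (measurableT_comp (measurable_powR _)).
  exact: exprn_measurable.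
apply/funext => x; rewrite powR_inv1 ?sqr_ge0//.
have [->|x0] := eqVneq x 0; first by rewrite mul0r invr0.
by rewrite expr2 invfM mulrA divff// mul1r.
Qed.

Definition normalized_energy (K : realType) (T : K) (f : K -> K) : K :=
  1 / T ^+ 2 * \int[lebesgue_measure]_(t in `[0, T]) (f t ^+ 2).

(** The weight 2 t / T^2 integrates to 1 over ]0, T], and its product with the
    exponent x^2 / (4 t) is x^2 / (2 T^2), whose integral along a path is half
    the normalised energy. *)
Definition jensen_integrand (K : realType) (T t x : K) : K :=
  2 * t / T ^+ 2 * expR (x ^+ 2 / (4 * t)).

Lemma measurable_linear_weight (K : realType) (T : K) (D : set K) :
  measurable_fun D (fun t => (2 * t / T ^+ 2)%:E).
Proof.
apply/measurable_EFinP.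
by apply: measurable_funM => //; apply: measurable_funM.
Qed.

Lemma linear_weight_ge0 (K : realType) (T t : K) :
  t \in `]0, T] -> 0 <= 2 * t / T ^+ 2.
Proof.
rewrite in_itv/= => /andP[/ltW t0 _].
by rewrite divr_ge0 ?sqr_ge0// mulr_ge0.
Qed.

Lemma jensen_integrand_ge0 (K : realType) (T t x : K) :
  t \in `]0, T] -> 0 <= jensen_integrand T t x.
Proof. by move=> tT; rewrite mulr_ge0 ?expR_ge0 ?linear_weight_ge0. Qed.

Lemma measurable_jensen_integrand (K : realType) (d : measure_display)
    (S : measurableType d) (D : set S) (T : K) (g h : S -> K) :
  measurable D -> measurable_fun D g -> measurable_fun D h ->
  measurable_fun D (fun z => (jensen_integrand T (g z) (h z))%:E).
Proof.
move=> mD mg mh; apply/measurable_EFinP; rewrite /jensen_integrand.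
apply: measurable_funM.
  by apply: measurable_funM => //; apply: measurable_funM.
apply: measurableT_comp => //; apply: measurable_funM.
  exact: measurable_funX.
apply: measurableT_comp; first exact: measurable_invr.
exact: measurable_funM.
Qed.

Lemma integral_linear_weight (K : realType) (T : K) : 0 < T ->
  (\int[lebesgue_measure]_(t in `]0%R, T]) (2 * t / T ^+ 2)%:E = 1)%E.
Proof.
move=> T0; rewrite integral_itv_obnd_cbnd; last first.
  exact: measurable_linear_weight.
pose F (t : K) := t ^+ 2 / T ^+ 2.
have dF (t : K) : is_derive t (1 : K) F (2 * t / T ^+ 2).
  rewrite /F; apply: is_derive_eq.
  by rewrite /GRing.scale/=; ring.
have cF : continuous F.
  by move=> t; apply/differentiable_continuous/derivable1_diffP; case: (dF t).
rewrite (@continuous_FTC2 _ _ F)//.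
- by rewrite /F expr0n/= mul0r sube0 divff// expf_neq0// gt_eqF.
- apply: continuous_subspaceT => t; apply: cvgM; last exact: cvg_cst.
  by apply: cvgM; [exact: cvg_cst|exact: cvg_id].
- split; [by move=> t _; case: (dF t)| |].
  + exact/cvg_at_right_filter/cF.
  + exact/cvg_at_left_filter/cF.
- by move=> t _; rewrite derive1E; apply: derive_val.
Qed.

(** Jensen's inequality for the probability density 2 t / T^2.  The interval is
    open at 0 because the exponent f t ^+ 2 / (4 t) is singular there. *)
Lemma expR_energy_le (K : realType) (T : K) (f : K -> K) : 0 < T ->
  {within `[0, T], continuous f} ->
  ((expR (normalized_energy T f / 2))%:E
   <= \int[lebesgue_measure]_(t in `]0%R, T])
        (jensen_integrand T t (f t))%:E)%E.
Proof.
move=> T0 cf; rewrite /normalized_energy.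
set I := Rintegral _ _ _; pose c := 1 / T ^+ 2 * I / 2; rewrite -/c.
have TN0 : T != 0 by rewrite gt_eqF.
have sub : `]0, T] `<=` `[0, T] by apply: subset_itvr; rewrite bnd_simp.
have if2 : lebesgue_measure.-integrable `[0, T] (EFin \o (fun t => f t ^+ 2)).
  apply: continuous_compact_integrable; first exact: segment_compact.
  apply: (@within_continuous_comp _ _ _ _ f (fun x : K => x ^+ 2)) => //.
  by move=> x _; exact: exprn_continuous.
have mf2 : measurable_fun `]0, T] (EFin \o (fun t => f t ^+ 2)).
  exact: measurable_funS sub (measurable_int _ if2).
have if2' : lebesgue_measure.-integrable `]0, T] (EFin \o (fun t => f t ^+ 2)).
  exact: integrableS if2.
have If2 : (\int[lebesgue_measure]_(t in `]0%R, T]) (f t ^+ 2)%:E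
    = (2 * T ^+ 2 * c)%:E)%E.
  rewrite integral_itv_obnd_cbnd// -[LHS]fineK; last first.
    exact: integrable_fin_num if2.
  by rewrite -[fine _]/I; congr EFin; rewrite /c; field; rewrite gt_eqF.
have iw : lebesgue_measure.-integrable `]0, T] (fun t => (2 * t / T ^+ 2)%:E).
  apply/integrableP; split.
    exact: measurable_linear_weight.
  rewrite (eq_integral (fun t : measurableTypeR K =>
    (2 * t / T ^+ 2)%:E)) => [|t].
    by rewrite integral_linear_weight// ltry.
  by rewrite inE/= => tT; rewrite ger0_norm// linear_weight_ge0.
have mf : measurable_fun `]0, T] f.
  apply: (measurable_funS _ sub) => //.
  exact: subspace_continuous_measurable_fun.
have mG : measurable_fun `]0, T] (fun t => (jensen_integrand T t (f t))%:E).
  exact: measurable_jensen_integrand.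
have G0 t : `]0, T]%classic t -> (0 <= (jensen_integrand T t (f t))%:E)%E.
  by move=> tT; rewrite lee_fin jensen_integrand_ge0.
(* The right-hand side is infinite when f 0 != 0. *)
set J := leRHS; have [|ltJ] := leP +oo%E J.
  by rewrite leye_eq => /eqP ->; rewrite leey.
have iG : lebesgue_measure.-integrable `]0, T]
    (fun t => (jensen_integrand T t (f t))%:E).
  apply/integrableP; split => //.
  rewrite (eq_integral (fun t : measurableTypeR K =>
    (jensen_integrand T t (f t))%:E))// => t.
  by rewrite inE => /G0; exact: gee0_abs.
(* Convexity of exp at the mean c of the exponent Y gives
   expR Y >= expR c * (1 + Y - c), whose weighted integral is expR c. *)
pose tangent t := ((expR c * (1 - c))%:E * (2 * t / T ^+ 2)%:E
  + (expR c / (2 * T ^+ 2))%:E * (f t ^+ 2)%:E)%E.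
rewrite [leLHS](_ : _ =
    \int[lebesgue_measure]_(t in `]0%R, T]) tangent t)%E; last first.
  rewrite integralD//; [|exact: integrableZl|exact: integrableZl].
  rewrite integralZl// integralZl// integral_linear_weight// If2 mule1.
  by rewrite -EFinM -EFinD; congr EFin; field.
apply: le_integral => //.
  by apply: integrableD => //; exact: integrableZl.
move=> t; rewrite inE/= in_itv/= => /andP[t0 _].
rewrite /tangent -!EFinM -EFinD lee_fin /jensen_integrand.
set Y := f t ^+ 2 / (4 * t).
have -> : expR c * (1 - c) * (2 * t / T ^+ 2)
      + expR c / (2 * T ^+ 2) * f t ^+ 2
    = 2 * t / T ^+ 2 * (expR c * (1 + (Y - c))).
  by rewrite /Y; field; rewrite gt_eqF// TN0.
apply: ler_wpM2l; first by rewrite divr_ge0 ?sqr_ge0// mulr_ge0// ltW.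
rewrite -[in leRHS](subrKC c Y) expRD; apply: ler_wpM2l; first exact: expR_ge0.
exact: expR_ge1Dx.
Qed.

(** * Tail of the energy of Brownian motion *)

Lemma measurable_paths (K : realType) (d : measure_display)
    (Omega : measurableType d) (P : probability Omega K)
    (B : K -> {RV P >-> K}) (D : set (measurableTypeR K)) :
  standard_brownian_motion B -> measurable D ->
  D `<=` `[0, +oo[%classic ->
  measurable_fun (D `*` setT : set (measurableTypeR K * Omega))
    (fun z => B z.1 z.2).
Proof.
move=> hB mD D0.
apply: (@measurable_funS _ _ _ _
  (`[0, +oo[%classic `*` setT : set (measurableTypeR K * Omega))).
- exact: measurableX.
- by move=> [t w] [/= /D0].
- apply: (@measurable_fun_continuous_paths _ _ _ (fun t w => B t w)) => //.
  exact: bm_continuous hB.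
Qed.

Lemma measurable_energy (K : realType) (d : measure_display)
    (Omega : measurableType d) (P : probability Omega K)
    (B : K -> {RV P >-> K}) (T : K) :
  standard_brownian_motion B ->
  measurable_fun [set: Omega] (fun w => normalized_energy T (fun t => B t w)).
Proof.
move=> hB; apply: measurable_funM => //.
apply: (measurableT_comp (@fine_measurable K setT measurableT)) => //.
apply: (@measurable_fun_integral_setX _ _ _ (measurableTypeR K) _
  lebesgue_measure `[0, T]%classic (fun z => (B z.1 z.2 ^+ 2)%:E)) => //.
- apply/measurable_EFinP/measurable_funX; apply: (measurable_paths hB) => //.
  by apply: subset_itv; rewrite bnd_simp.
- by move=> z _; rewrite lee_fin sqr_ge0.
Qed.

Lemma normalized_energy_ge0 (K : realType) (T : K) (f : K -> K) :
  0 <= normalized_energy T f.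
Proof.
rewrite mulr_ge0 ?divr_ge0 ?sqr_ge0// Rintegral_ge0// => t _.
exact: sqr_ge0.
Qed.

(** By Tonelli's theorem the expectation may be taken first, and it is
    sqrt 2 * (2 t / T^2) at every time t. *)
Lemma integral_jensen_integrand_bm (K : realType) (d : measure_display)
    (Omega : measurableType d) (P : probability Omega K)
    (B : K -> {RV P >-> K}) (T : K) :
  standard_brownian_motion B -> 0 < T ->
  (\int[P]_w \int[lebesgue_measure]_(t in `]0%R, T])
     (jensen_integrand T t (B t w))%:E = (Num.sqrt 2)%:E)%E.
Proof.
move=> hB T0.
have mD : measurable (`]0, T]%classic : set (measurableTypeR K)) by [].
have D0 : `]0, T] `<=` `[0, +oo[ by apply: subset_itv; rewrite bnd_simp.
have mB := measurable_paths hB mD D0.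
rewrite (@fubini_tonelli_setX _ _ _ (measurableTypeR K) _
  lebesgue_measure P `]0, T]%classic
  (fun z => (jensen_integrand T z.1 (B z.1 z.2))%:E))//=; first last.
- by move=> z zD; rewrite lee_fin jensen_integrand_ge0.
- apply: measurable_jensen_integrand => //; first exact: measurableX.
  exact: measurable_funTS.
rewrite (eq_integral (fun t : measurableTypeR K =>
    (Num.sqrt 2)%:E * (2 * t / T ^+ 2)%:E)%E); last first.
  move=> t; rewrite inE/= => tT; have t0 : 0 < t by rewrite (itvP tT).
  under eq_integral do rewrite EFinM.
  rewrite ge0_integralZl//.
  - by rewrite brownian_motion_exp_sqr// muleC.
  - apply/measurable_EFinP/measurableT_comp => //.
    by apply: measurable_funM => //; exact: measurable_funX.
  - by rewrite lee_fin linear_weight_ge0.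
rewrite ge0_integralZl//.
- by rewrite integral_linear_weight// mule1.
- exact: measurable_linear_weight.
- by move=> t tT; rewrite lee_fin linear_weight_ge0.
Qed.

Lemma measurable_energy_ge (K : realType) (d : measure_display)
    (Omega : measurableType d) (P : probability Omega K)
    (B : K -> {RV P >-> K}) (T a : K) :
  standard_brownian_motion B ->
  measurable [set w | a <= normalized_energy T (fun t => B t w)].
Proof.
move=> hB; rewrite (_ : mkset _ =
    setT `&` (fun w => normalized_energy T (fun t => B t w)) @^-1` `[a, +oo[).
  exact: measurable_energy.
by apply/seteqP; split=> w /=; rewrite in_itv/= andbT => // -[].
Qed.

(** Markov's inequality for exp (E / 2), whose expectation is at most sqrt 2. *)
Lemma energy_tail (K : realType) (d : measure_display)
    (Omega : measurableType d) (P : probability Omega K)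
    (B : K -> {RV P >-> K}) (T a : K) :
  standard_brownian_motion B -> 0 < T ->
  (P [set w | (a <= normalized_energy T (fun t => B t w))%R]
   <= (Num.sqrt 2 * expR (- (a / 2)))%:E)%E.
Proof.
move=> hB T0.
pose J w := (\int[lebesgue_measure]_(t in `]0%R, T])
  (jensen_integrand T t (B t w))%:E)%E.
have mD : measurable (`]0, T]%classic : set (measurableTypeR K)) by [].
have D0 : `]0, T] `<=` `[0, +oo[ by apply: subset_itv; rewrite bnd_simp.
have J0 w : (0 <= J w)%E.
  by apply: integral_ge0 => t tT; rewrite lee_fin jensen_integrand_ge0.
have mJ : measurable_fun [set: Omega] J.
  apply: (@measurable_fun_integral_setX _ _ _ (measurableTypeR K) _
    lebesgue_measure `]0, T]%classic
    (fun z => (jensen_integrand T z.1 (B z.1 z.2))%:E)) => //.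
  - apply: measurable_jensen_integrand; first exact: measurableX.
      exact: measurable_funTS.
    exact: (measurable_paths hB).
  - by move=> z zD; rewrite lee_fin jensen_integrand_ge0.
have EJ : (\int[P]_w `|J w| = (Num.sqrt 2)%:E)%E.
  rewrite -(integral_jensen_integrand_bm hB T0); apply: eq_integral => w _.
  exact: gee0_abs.
have ea0 := expR_gt0 (a / 2).
rewrite mulrC expRN EFinM lee_pdivlMl// -EJ.
apply: le_trans (le_integral_abse P measurableT mJ ea0).
rewrite setTI lee_pmul2l ?fin_numE// ?lte_fin//.
apply: le_measure; rewrite ?inE.
- exact: measurable_energy_ge.
- rewrite -[X in measurable X]setTI; apply: emeasurable_fun_c_infty => //.
  exact: measurableT_comp.
move=> w /= aw; rewrite gee0_abs//.
have cB : {within `[0, T], continuous (fun t => B t w)}.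
  apply: continuous_subspaceW (@bm_continuous _ _ _ _ _ hB w).
  by apply: subset_itv; rewrite bnd_simp.
apply: le_trans (expR_energy_le T0 cB).
by rewrite lee_fin ler_expR ler_pM2r.
Qed.

(** * Comparison with the claimed bound *)

Lemma powR2_third_ge (K : realType) : 5 / 4 <= 2 `^ (1 / 3) :> K.
Proof.
rewrite -(@ler_pXn2r _ 3)// ?nnegrE ?powR_ge0//.
by rewrite -[leRHS]powR_mulrn ?powR_ge0// -powRrM mul1r mulVf// powRr1//; lra.
Qed.

Lemma sqr1D_le_expR (K : realType) (z : K) : -1 <= z ->
  (1 + z) ^+ 2 <= expR (2 * z).
Proof.
move=> z1; rewrite mulrC expRM_natr ler_pXn2r ?nnegrE ?expR_ge0//.
  exact: expR_ge1Dx.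
by lra.
Qed.

(** For R <= 3/2 the minimum is 1 and R^2 / (3 (4 R + 3/4)) <= 1/9, while
    2^(1/3) * exp (- 1/9) >= (5/4) * (8/9) > 1. *)
Lemma bound_ge1 (K : realType) (R : K) : 0 < R -> R <= 3 / 2 ->
  1 <= 2 `^ (1 / 3) * Num.min 1 ((4 * R + 3 / 4) / (3 * R ^+ 2))
       * expR (- (R ^+ 2 / (3 * (4 * R + 3 / 4)))).
Proof.
move=> R0 R32; have R2 : 0 < R ^+ 2 by rewrite exprn_gt0.
rewrite min_l; last by rewrite ler_pdivlMr ?mulr_gt0//; nra.
have x19 : R ^+ 2 / (3 * (4 * R + 3 / 4)) <= 1 / 9.
  by rewrite ler_pdivrMr; nra.
have := expR_ge1Dx (- (R ^+ 2 / (3 * (4 * R + 3 / 4)))).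
have := powR2_third_ge K.
by rewrite mulr1; nra.
Qed.

(** As 4 R + 3/4 >= 4 R and 2^(1/3) >= 5/4, the right-hand side is at least
    (5/4) * (4 / (3 R)) * exp (- R / 12).  It then remains to see that
    sqrt 2 * 3 R / 5 <= exp (5 R / 12 + 1/4), where the square of the linear
    bound on exp at half the exponent is large enough. *)
Lemma tail_le_bound (K : realType) (R : K) : 3 / 2 < R ->
  Num.sqrt 2 * expR (- ((R + 1 / 2) / 2))
  <= 2 `^ (1 / 3) * Num.min 1 ((4 * R + 3 / 4) / (3 * R ^+ 2))
     * expR (- (R ^+ 2 / (3 * (4 * R + 3 / 4)))).
Proof.
move=> R32; have R0 : 0 < R by lra.
have R2 : 0 < R ^+ 2 by rewrite exprn_gt0.
rewrite min_r; last by rewrite ler_pdivrMr ?mulr_gt0//; nra.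
have exp_le : expR (- (R / 12)) <= expR (- (R ^+ 2 / (3 * (4 * R + 3 / 4)))).
  by rewrite ler_expR lerN2 ler_pdivrMr; nra.
have frac_ge : 4 / (3 * R) <= (4 * R + 3 / 4) / (3 * R ^+ 2).
  by rewrite ler_pdivrMr ?mulr_gt0// mulrAC ler_pdivlMr ?mulr_gt0//; nra.
apply: le_trans (_ : 5 / 4 * (4 / (3 * R)) * expR (- (R / 12)) <= _).
  have -> : - (R / 12) = - ((R + 1 / 2) / 2) + 2 * (5 / 24 * R + 1 / 8).
    by field.
  rewrite expRD [leRHS]mulrCA [leLHS]mulrC; apply: ler_wpM2l.
    exact: expR_ge0.
  have sqrt2 : Num.sqrt 2 <= 3 / 2 :> K.
    rewrite -(@ler_pXn2r _ 2)// ?nnegrE ?sqrtr_ge0// ?sqr_sqrtr//; lra.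
  apply: (le_trans sqrt2).
  have -> : 5 / 4 * (4 / (3 * R)) = 5 / (3 * R) by field; rewrite gt_eqF.
  have z1 : -1 <= 5 / 24 * R + 1 / 8 by lra.
  rewrite mulrAC ler_pdivlMr ?mulr_gt0//.
  (* The difference of the two quadratics is smallest near R = 5. *)
  have := sqr1D_le_expR z1; have := sqr_ge0 (R - 5).
  set e := expR _; rewrite !expr2 => h1 h2.
  lra.
have q0 : 0 <= 4 / (3 * R) by rewrite divr_ge0// mulr_ge0// ltW.
have c0 : (0 : K) <= 5 / 4 by lra.
apply: ler_pM exp_le; [exact: mulr_ge0|exact: expR_ge0|].
exact: ler_pM (powR2_third_ge K) frac_ge.
Qed.

(** * The concentration inequality *)

Theorem proposition4p13 (K : realType) (d : measure_display)
    (Omega : measurableType d) (P : probability Omega K)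
    (B : K -> {RV P >-> K}) (hB : standard_brownian_motion B)
    (R T : K) (hR : 0 < R) (hT : 0 < T) :
  (P [set w : Omega |
        (R <= `| 1 / T ^+ 2 * \int[lebesgue_measure]_(t in `[0, T]) (B t w ^+ 2)
                 - 1 / 2 |)%R]
   <= (2 `^ (1 / 3)
       * Num.min 1 ((4 * R + 3 / 4) / (3 * R ^+ 2))
       * expR (- (R ^+ 2 / (3 * (4 * R + 3 / 4)))))%:E)%E.
Proof.
pose E w := normalized_energy T (fun t => B t w).
have mE : measurable_fun setT E by exact: measurable_energy.
have mdev : measurable [set w | R <= `|E w - 1 / 2|].
  rewrite (_ : mkset _ = setT `&` (fun w => `|E w - 1 / 2|) @^-1` `[R, +oo[).
    have : measurable_fun setT (fun w => `|E w - 1 / 2|).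
      by apply: measurableT_comp => //; exact: measurable_funB.
    exact.
  by apply/seteqP; split=> w /=; rewrite in_itv/= andbT => // -[].
have [R32|R32] := leP R (3 / 2).
  apply: le_trans (probability_le1 P mdev) _.
  by rewrite lee_fin; exact: bound_ge1.
apply: (@le_trans _ _ (P [set w | (R + 1 / 2 <= E w)%R])).
  apply: le_measure; rewrite ?inE//; first exact: measurable_energy_ge.
  move=> w; change (R <= `|E w - 1 / 2| -> R + 1 / 2 <= E w).
  (* E is nonnegative and R > 1/2, so only E >= R + 1/2 is possible. *)
  have E0 : 0 <= E w := normalized_energy_ge0 T _.
  by move: (E w) E0 => e e0; rewrite ler_normr => /orP[]; lra.
apply: le_trans (energy_tail (R + 1 / 2) hB hT) _.
by rewrite lee_fin; exact: tail_le_bound.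
Qed.
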